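(* A cross section of $\mathcal{P}_\beta$ perpendicular to nine spheres in a cluster of ten mutually tangent spheres in $\mathcal{P}_\beta$ yields (up to isometry of Lorentz space) the sphere packing in $\mathbb{R}^7$ with the following Coxeter graph on nine nodes $a_1,\dots,a_9$: all edges are simple; $a_1,\dots,a_7$ form a $7$-cycle with edges $a_1a_2,a_2a_3,\dots,a_6a_7,a_7a_1$; and there is a tail with edges $a_7a_8$, $a_8a_9$. This packing is of general lattice type.
   Context: The packing $\mathcal{P}_\beta$. Let $\mathbb{R}^{1,9}$ be the real vector space with basis $\beta_0,\dots,\beta_9$ and symmetric bilinear form given by $\beta_i\cdot\beta_i=-2$, and, for $i\ne j$, $\beta_i\cdot\beta_j=1$ if $\{i,j\}$ is one of $\{1,2\},\{2,3\},\{3,4\},\{4,5\},\{5,6\},\{6,7\},\{7,8\},\{8,9\},\{0,4\}$, and $0$ otherwise (signature $(1,9)$). For $\mathbf n\cdot\mathbf n<0$ put $R_{\mathbf n}(\mathbf x)=\mathbf x-2\frac{\mathbf n\cdot\mathbf x}{\mathbf n\cdot\mathbf n}\mathbf n$. Let $\nu$ be the vector with $\nu\cdot\beta_9=2$, $\nu\cdot\beta_i=0$ for $i\ne9$ (so $\nu\cdot\nu=-2$), $\Gamma=\langle R_{\beta_0},\dots,R_{\beta_9}\rangle$ and $\mathcal{P}_\beta=\Gamma(\nu)$. This is a packing: $\mathbf n\cdot\mathbf n=-2$ for $\mathbf n\in\mathcal{P}_\beta$ and $\mathbf n\cdot\mathbf n'\ge2$ for distinct $\mathbf n,\mathbf n'$.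 Each $\mathbf n$ represents a hyperplane $\{\mathbf n\cdot\mathbf x=0\}$ of $\mathbb{H}^9$ and hence a sphere in its boundary; distinct $\mathbf n,\mathbf n'$ are tangent if $\mathbf n\cdot\mathbf n'=2$ and perpendicular if the product is $0$. Cross section. Given ten pairwise tangent elements of $\mathcal{P}_\beta$ and nine of them, let $h$ be a nonzero vector orthogonal to these nine (it spans a line and $h\cdot h<0$), and let $H=h^\perp\cong\mathbb{R}^{1,8}$ be the hyperplane perpendicular to them. The cross section of $\mathcal{P}_\beta$ by $H$ is the set of vectors $\mathbf n-\frac{\mathbf n\cdot h}{h\cdot h}h\in H$, for those $\mathbf n\in\mathcal{P}_\beta$ for which this projection has negative norm (i.e. for which the sphere meets $H$ non-tangentially), each taken up to positive scaling. It represents the spheres in $7$ dimensions cut out on $H$ by the spheres of $\mathcal{P}_\beta$. Packing of a Coxeter graph. For the graph above, let $\mathbb{R}^{1,8}$ have basis $a_1,\dots,a_9$ with $a_i\cdot a_i=-2$, $a_i\cdot a_j=1$ if $a_ia_j$ is an edge, and $0$ otherwise for $i\neq j$. Let $w_1,\dots,w_9$ be the weights, $w_i\cdot a_j=\delta_{ij}$, and let $W=\langle R_{a_1},\dots,R_{a_9}\rangle$. The weights of negative norm (those representing hyperplanes) are $w_3,w_4,w_9$, and the packing with this Coxeter graph is $W(\{w_3,w_4,w_9\})$, each vector taken up to positive scaling. A packing $\mathcal{P}\subset\mathbb{R}^{1,N-1}$ is of general lattice type if $\mathcal{P}$ spans $\mathbb{R}^{1,N-1}$ and there is a lattice $\Lambda\subset\mathbb{R}^{1,N-1}$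 such that a (nonzero) scalar multiple of $\mathbf n$ lies in $\Lambda$ for every $\mathbf n\in\mathcal{P}$. *)

(* Defs.v *)
From HB Require Import structures.
From mathcomp Require Import all_boot all_order all_algebra.
From mathcomp Require Import boolp classical_sets reals.

Set Implicit Arguments.
Unset Strict Implicit.
Unset Printing Implicit Defensive.

Import Order.TTheory GRing.Theory Num.Theory.

Local Open Scope classical_set_scope.
Local Open Scope ring_scope.

(* A Lorentz space is R^n, written as row vectors of coordinates in its basis,
   with the symmetric bilinear form given by the Gram matrix G of the basis. *)
Section LorentzSpace.
Variables (R : realType) (n : nat) (G : 'M[R]_n).
Implicit Types (h u v x y : 'rV[R]_n) (A P : set 'rV[R]_n).

Definition lform x y : R := (x *m G *m y^T) 0 0.

Definition basis_vec (i : 'I_n) : 'rV[R]_n := delta_mx 0 i.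

(* The dual basis: see form_weight below. *)
Definition weight (i : 'I_n) : 'rV[R]_n := row i (invmx G).

Definition reflection v x : 'rV[R]_n := x - (2 * (lform v x / lform v v)) *: v.

Definition hyperplane h : set 'rV[R]_n := [set x | lform h x = 0].

Definition projection h x : 'rV[R]_n := x - (lform x h / lform h h) *: h.

(* Sets of vectors taken up to positive scaling are represented by the unions
   of the open rays spanned by their elements. *)
Definition rays A : set 'rV[R]_n :=
  [set x | exists c y, [/\ 0 < c, A y & x = c *: y]].

Definition cross_section P h : set 'rV[R]_n :=
  rays [set y | lform y y < 0 /\ exists2 x, P x & y = projection h x].

(* Tangency is a relation between distinct elements. *)
Definition pairwise_tangent m (c : 'I_m -> 'rV[R]_n) : Prop :=
  injective c /\ forall i j, i != j -> lform (c i) (c j) = 2.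

End LorentzSpace.

Inductive generated_group (T : Type) (S : set (T -> T)) : set (T -> T) :=
| generated_gen f : S f -> generated_group S f
| generated_id : generated_group S id
| generated_comp f g : generated_group S f -> generated_group S g ->
    generated_group S (f \o g)
| generated_inv f g : generated_group S f -> cancel f g -> cancel g f ->
    generated_group S g.

Definition reflection_group (R : realType) n (G : 'M[R]_n) :
    set ('rV[R]_n -> 'rV[R]_n) :=
  generated_group [set reflection G (basis_vec R i) | i in [set: 'I_n]].

Definition orbit_of T (Gamma : set (T -> T)) (A : set T) : set T :=
  [set x | exists g v, [/\ Gamma g, A v & x = g v]].

Definition coxeter_gram (R : realType) n (adj : rel 'I_n) : 'M[R]_n :=
  \matrix_(i, j) (if i == j then -2 else (adj i j)%:R).

Definition edge_rel (E : seq (nat * nat)) : rel nat :=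
  [rel i j | ((i, j) \in E) || ((j, i) \in E)].

Definition beta_edges : seq (nat * nat) :=
  [:: (1, 2); (2, 3); (3, 4); (4, 5); (5, 6); (6, 7); (7, 8); (8, 9);
      (0, 4)]%N.

Definition cycle_tail_edges : seq (nat * nat) :=
  [:: (1, 2); (2, 3); (3, 4); (4, 5); (5, 6); (6, 7); (7, 1); (7, 8);
      (8, 9)]%N.

Definition beta_gram (R : realType) : 'M[R]_10 :=
  coxeter_gram R [rel i j : 'I_10 | edge_rel beta_edges i j].

(* The nodes a_1, ..., a_9 are numbered from 1: the index i : 'I_9 stands for
   a_(i.+1). *)
Definition cycle_tail_gram (R : realType) : 'M[R]_9 :=
  coxeter_gram R [rel i j : 'I_9 | edge_rel cycle_tail_edges i.+1 j.+1].

Definition nu (R : realType) : 'rV[R]_10 := 2 *: weight (beta_gram R) ord_max.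

Definition P_beta (R : realType) : set 'rV[R]_10 :=
  orbit_of (reflection_group (beta_gram R)) [set nu R].

Definition cycle_tail_packing (R : realType) : set 'rV[R]_9 :=
  rays (orbit_of (reflection_group (cycle_tail_gram R))
    [set weight (cycle_tail_gram R) i
      | i in [set i : 'I_9 | i.+1 \in [:: 3; 4; 9]%N]]).

Arguments P_beta R : clear implicits.
Arguments cycle_tail_packing R : clear implicits.

Definition isometry_onto (R : realType) m n (G : 'M[R]_m) (K : 'M[R]_n)
    (phi : 'rV[R]_m -> 'rV[R]_n) (H : set 'rV[R]_n) : Prop :=
  (forall x y, lform K (phi x) (phi y) = lform G x y) /\ range phi = H.

Definition spans (R : realType) n (P : set 'rV[R]_n) : Prop :=
  forall x, exists m (c : 'I_m -> R) (v : 'I_m -> 'rV[R]_n),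
    (forall i, P (v i)) /\ x = \sum_(i < m) c i *: v i.

(* Integral combinations of the rows of an invertible matrix. *)
Definition is_lattice (R : realType) n (L : set 'rV[R]_n) : Prop :=
  exists2 B : 'M[R]_n, B \in unitmx &
    L = [set map_mx intr z *m B | z in [set: 'rV[int]_n]].

Definition general_lattice_type (R : realType) n (P : set 'rV[R]_n) : Prop :=
  spans P /\
  exists2 L, is_lattice L &
    forall x, P x -> exists2 c : R, c != 0 & L (c *: x).

Lemma form_weight (R : realType) n (G : 'M[R]_n) (i j : 'I_n) :
  G \in unitmx -> lform G (weight G i) (basis_vec R j) = (i == j)%:R.
Proof.
move=> Gu; rewrite /lform /weight /basis_vec -row_mul mulVmx // trmx_delta -colE.
by rewrite !mxE.
Qed.

Definition beta_dual_entries : seq (seq int) := [::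
  [:: 10; 6; 12; 18; 24; 20; 16; 12; 8; 4];
  [:: 6; 0; 4; 8; 12; 10; 8; 6; 4; 2];
  [:: 12; 4; 8; 16; 24; 20; 16; 12; 8; 4];
  [:: 18; 8; 16; 24; 36; 30; 24; 18; 12; 6];
  [:: 24; 12; 24; 36; 48; 40; 32; 24; 16; 8];
  [:: 20; 10; 20; 30; 40; 30; 24; 18; 12; 6];
  [:: 16; 8; 16; 24; 32; 24; 16; 12; 8; 4];
  [:: 12; 6; 12; 18; 24; 18; 12; 6; 4; 2];
  [:: 8; 4; 8; 12; 16; 12; 8; 4; 0; 0];
  [:: 4; 2; 4; 6; 8; 6; 4; 2; 0; -2]]%Z.

Definition cycle_tail_dual_entries : seq (seq int) := [::
  [:: 9; 11; 13; 15; 17; 19; 21; 14; 7];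
  [:: 11; 1; 5; 9; 13; 17; 21; 14; 7];
  [:: 13; 5; -3; 3; 9; 15; 21; 14; 7];
  [:: 15; 9; 3; -3; 5; 13; 21; 14; 7];
  [:: 17; 13; 9; 5; 1; 11; 21; 14; 7];
  [:: 19; 17; 15; 13; 11; 9; 21; 14; 7];
  [:: 21; 21; 21; 21; 21; 21; 21; 14; 7];
  [:: 14; 14; 14; 14; 14; 14; 14; 0; 0];
  [:: 7; 7; 7; 7; 7; 7; 7; 0; -7]]%Z.

Definition entries_mx (R : realType) n (s : seq (seq int)) : 'M[R]_n :=
  \matrix_(i, j) (nth 0 (nth [::] s i) j)%:~R.

Lemma invmx_scalar (R : realType) n (G B : 'M[R]_n) (d : R) :
  d != 0 -> G *m B = d%:M -> G \in unitmx /\ invmx G = d^-1 *: B.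
Proof.
move=> d0 GB.
have GdB : G *m (d^-1 *: B) = 1%:M.
  by rewrite -scalemxAr GB scale_scalar_mx mulVf.
have [Gu _] := mulmx1_unit GdB; split=> //.
by rewrite -[LHS]mulmx1 -GdB mulKmx.
Qed.

Lemma coxeter_gram_mul (R : realType) n (adj : rel nat) s (d : int) :
  all (fun i => all (fun j =>
    foldr (fun k x => (if i == k then -2 else Posz (adj i k)) *
                      nth 0 (nth [::] s k) j + x) 0 (iota 0 n) ==
    (if i == j then d else 0)) (iota 0 n)) (iota 0 n) ->
  coxeter_gram R [rel i j : 'I_n | adj i j] *m entries_mx R n s = d%:~R%:M.
Proof.
move=> /allP Hs; apply/matrixP => i j; rewrite !mxE.
have iP : (i : nat) \in iota 0 n by rewrite mem_iota ltn_ord.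
have jP : (j : nat) \in iota 0 n by rewrite mem_iota ltn_ord.
have /allP/(_ _ jP)/eqP Hij := Hs _ iP.
transitivity ((if (i : nat) == j then d else 0)%:~R : R); last first.
  by rewrite -val_eqE; case: ifP.
have foldr_sum (F : nat -> int) r :
    foldr (fun k x => F k + x) 0 r = \sum_(k <- r) F k.
  by elim: r => [|k r IH]; rewrite ?big_nil // big_cons -IH.
rewrite -Hij foldr_sum rmorph_sum /= -[X in iota 0 X]subn0.
rewrite -[iota 0 (n - 0)]/(index_iota 0 n) big_mkord.
apply: eq_bigr => k _; rewrite !mxE rmorphM /= val_eqE.
by case: ifP.
Qed.

Lemma beta_gram_inv (R : realType) :
  beta_gram R \in unitmx /\
  invmx (beta_gram R) = 4^-1 *: entries_mx R 10 beta_dual_entries.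
Proof.
apply: invmx_scalar; first by rewrite pnatr_eq0.
exact: (@coxeter_gram_mul R 10 (edge_rel beta_edges) beta_dual_entries 4).
Qed.

Lemma cycle_tail_gram_inv (R : realType) :
  cycle_tail_gram R \in unitmx /\
  invmx (cycle_tail_gram R) = 14^-1 *: entries_mx R 9 cycle_tail_dual_entries.
Proof.
apply: invmx_scalar; first by rewrite pnatr_eq0.
exact: (@coxeter_gram_mul R 9 [rel i j | edge_rel cycle_tail_edges i.+1 j.+1]
  cycle_tail_dual_entries 14).
Qed.

Lemma form_weight_weight (R : realType) n (G : 'M[R]_n) (i : 'I_n) :
  G \in unitmx -> G^T = G ->
  lform G (weight G i) (weight G i) = invmx G i i.
Proof.
move=> Gu Gs; rewrite /lform /weight -row_mul mulVmx // tr_row trmx_inv Gs.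
by rewrite !mxE (bigD1 i) //= !mxE eqxx mul1r big1 ?addr0 // => k /negPf ki;
  rewrite !mxE eq_sym ki mul0r.
Qed.

Lemma cycle_tail_weight_norm (R : realType) (i : 'I_9) :
  let w := weight (cycle_tail_gram R) i in
  (lform (cycle_tail_gram R) w w < 0) = (i.+1 \in [:: 3; 4; 9]%N).
Proof.
move=> w; have [Gu GV] := cycle_tail_gram_inv R.
rewrite /w form_weight_weight //; last first.
  apply/matrixP => k l; rewrite !mxE eq_sym; congr (if _ then _ else _).
  congr ((nat_of_bool _)%:R); exact: orbC.
rewrite GV !mxE pmulr_rlt0 ?invr_gt0 ?ltr0n // ltrz0.
by case: i {w} => -[|[|[|[|[|[|[|[|[|i]]]]]]]]].
Qed.

(* Main.v *)
Require Import Defs.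
From mathcomp Require Import all_boot all_order all_algebra.
From mathcomp Require Import boolp classical_sets reals.
From mathcomp Require Import ring lra.
Import Order.TTheory GRing.Theory Num.Theory.
Local Open Scope classical_set_scope.
Local Open Scope ring_scope.

Set Implicit Arguments.
Unset Strict Implicit.
Unset Printing Implicit Defensive.

(* Every vector of a simply laced Coxeter orbit of a dominant vector v is reached
   from v by ascending reflections. Hence, for dominant p, an orbit vector outside
   a finite set L containing v has p-value at least that of some neighbour of L
   outside L, and there are finitely many neighbours. With
   L = {nu} this gives n.n' >= 2 on P_beta.

   Given a cluster d of ten and an index k, move p = sum_i d_i + d_k into the
   chamber by Gamma. Members of the cluster have p-value at most 18, all other
   elements of P_beta at least 22, so neighbours of a part of the cluster can be
   chosen in the cluster; starting from d_k = nu this identifies the cluster with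
   e_1, ..., e_9, e_10 = nu, where e_i - e_(i+1) = 2 beta_i. Thus h may be taken
   to be one fixed vector, orthogonal to beta_1, ..., beta_8 and to
   (e_7 + e_8 + e_9 - e_1) / 2, a root of Gamma; these nine roots have the
   Coxeter graph a_1, ..., a_9.

   The reflections in the a_i fix h and preserve P_beta, so every n in P_beta can
   be moved to one with n.a_i >= 0. Let q = sum_i z_i a_i be its projection, of
   negative norm. All z_i with i not in {3, 4, 9} are nonnegative. If n is none of
   the three elements n_3, n_4, n_9 of P_beta projecting to 2 w_3, 2 w_4, 2 w_9,
   then n.n_i >= 2 makes z_3, z_4, z_9 positive, and
   q.q = sum_i z_i (n.a_i) >= 0, a contradiction. *)

(** * The bilinear form of a Gram matrix, its reflections and words in them *)

Section Form.
Variables (R : realType) (n : nat) (G : 'M[R]_n).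
Implicit Types (v x y z : 'rV[R]_n).

Lemma lformDl x y z : lform G (x + y) z = lform G x z + lform G y z.
Proof. by rewrite /lform !mulmxDl mxE. Qed.

Lemma lformDr x y z : lform G z (x + y) = lform G z x + lform G z y.
Proof. by rewrite /lform linearD mulmxDr mxE. Qed.

Lemma lformZl c x y : lform G (c *: x) y = c * lform G x y.
Proof. by rewrite /lform -!scalemxAl mxE. Qed.

Lemma lformZr c x y : lform G x (c *: y) = c * lform G x y.
Proof. by rewrite /lform linearZ -scalemxAr mxE. Qed.

Lemma lform0l x : lform G 0 x = 0.
Proof. by rewrite /lform !mul0mx mxE. Qed.

Lemma lform_suml (I : finType) (F : I -> 'rV[R]_n) y :
  lform G (\sum_i F i) y = \sum_i lform G (F i) y.
Proof. by rewrite /lform !mulmx_suml summxE. Qed.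

Lemma lform_basis_vec i j : lform G (basis_vec R i) (basis_vec R j) = G i j.
Proof. by rewrite /lform /basis_vec -rowE trmx_delta -colE !mxE. Qed.

Lemma lform_basis_vecr x j : lform G x (basis_vec R j) = (x *m G) 0 j.
Proof. by rewrite /lform /basis_vec trmx_delta -colE !mxE. Qed.

Lemma row_sum_basis_vec x : x = \sum_i x 0 i *: basis_vec R i.
Proof. exact: row_sum_delta. Qed.

Lemma lform_sumr (I : finType) (F : I -> 'rV[R]_n) y :
  lform G y (\sum_i F i) = \sum_i lform G y (F i).
Proof. by rewrite /lform linear_sum mulmx_sumr summxE. Qed.

Lemma lform_expandr x y :
  lform G x y = \sum_i y 0 i * lform G x (basis_vec R i).
Proof.
by rewrite [in LHS](row_sum_basis_vec y) lform_sumr; apply: eq_bigr => i _;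
  rewrite lformZr.
Qed.

Lemma lform_nondegenerate x y : G \in unitmx ->
  (forall i, lform G x (basis_vec R i) = lform G y (basis_vec R i)) -> x = y.
Proof.
move=> Gu xy; apply: (can_inj (mulmxK Gu)); apply/rowP => i.
by rewrite -!lform_basis_vecr.
Qed.

Hypothesis Gs : G^T = G.

Lemma lformC x y : lform G x y = lform G y x.
Proof.
rewrite /lform; transitivity ((x *m G *m y^T)^T 0 0); first by rewrite [RHS]mxE.
by rewrite !trmx_mul trmxK Gs mulmxA.
Qed.

Definition root_vector v := lform G v v = -2.

Lemma reflectionE v x : root_vector v -> reflection G v x = x + lform G x v *: v.
Proof.
move=> vv; rewrite /reflection vv -scaleNr [lform G v x]lformC; congr (x + _ *: v).
by field.
Qed.

Lemma reflectionK v : root_vector v -> involutive (reflection G v).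
Proof.
move=> rv x; rewrite !reflectionE // lformDl lformZl rv.
by apply/rowP => k; rewrite !mxE; ring.
Qed.

Lemma lform_reflection v x y : root_vector v ->
  lform G (reflection G v x) (reflection G v y) = lform G x y.
Proof.
move=> rv; rewrite !reflectionE // !(lformDl, lformDr, lformZl, lformZr) rv.
by rewrite [lform G v y]lformC; ring.
Qed.

(** Linearity in matrix form, passed on to words by [word_mulmx]. *)
Lemma reflection_mulmx v : exists T, forall x, reflection G v x = x *m T.
Proof.
exists (1%:M - (2 / lform G v v) *: (G *m v^T *m v)) => x.
rewrite mulmxBr mulmx1 -scalemxAr !mulmxA; congr (_ - _).
rewrite [x *m G *m v^T]mx11_scalar mul_scalar_mx scalerA [lform G v x]lformC.
by rewrite -/(lform G x v); congr (_ *: _); rewrite mulrA mulrAC.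
Qed.

Section Words.
Variables (I : finType) (a : I -> 'rV[R]_n).

Definition word (s : seq I) x := foldr (fun i => reflection G (a i)) x s.

Lemma word_mulmx s : exists T, forall x, word s x = x *m T.
Proof.
elim: s => [|i s [T sT]]; first by exists 1%:M => x; rewrite mulmx1.
have [U iU] := reflection_mulmx (a i).
by exists (T *m U) => x; rewrite /= iU sT mulmxA.
Qed.

Lemma wordZ s c x : word s (c *: x) = c *: word s x.
Proof. by have [T sT] := word_mulmx s; rewrite !sT scalemxAl. Qed.

Hypothesis ra : forall i, root_vector (a i).

Lemma wordK s : cancel (word s) (word (rev s)).
Proof.
move=> x; elim/last_ind: s x => //= s i IH x.
by rewrite rev_rcons /= /word foldr_rcons -!/(word _ _) IH reflectionK.
Qed.

Lemma wordVK s : cancel (word (rev s)) (word s).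
Proof. by move=> x; rewrite -{1}[s]revK wordK. Qed.

Lemma lform_word s x y : lform G (word s x) (word s y) = lform G x y.
Proof. by elim: s => //= i s IH; rewrite lform_reflection. Qed.

(** Words are linear isometries, so conjugation by a word turns the reflection in a root into the
    one in its image. This puts reflections in non-simple roots into the group. *)
Lemma reflection_word s v x : root_vector v ->
  reflection G (word s v) x = word s (reflection G v (word (rev s) x)).
Proof.
move=> rv; have rsv : root_vector (word s v) by rewrite /root_vector lform_word.
rewrite !reflectionE //; have [T sT] := word_mulmx s.
rewrite [RHS]sT mulmxDl -scalemxAl -!sT wordVK.
by rewrite -(lform_word s (word (rev s) x)) wordVK.
Qed.

(** Reflecting in an [a i] of negative product lowers [m] by at least 1, and [m] stays above [b] on
    the stable set [X], so the process stops. The induction is on a bound [N] for the steps left. *)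
Lemma descent (X : 'rV[R]_n -> Prop) (m : 'rV[R]_n -> R) b :
  (forall x, X x -> b <= m x) ->
  (forall x i, X x -> X (reflection G (a i) x)) ->
  (forall x i, X x -> lform G x (a i) < 0 ->
     m (reflection G (a i) x) <= m x - 1) ->
  forall x, X x -> exists s, forall i, 0 <= lform G (word s x) (a i).
Proof.
move=> mb Xr mr x Xx.
have [N] : exists N : nat, m x < b + N%:R.
  by exists (Num.truncn (m x - b)).+1; rewrite -ltrBlDl truncnS_gt.
elim: N x Xx => [|N IH] x Xx mN.
  by have := mb x Xx; rewrite leNgt; move: mN; rewrite addr0 => ->.
have [/forallP ?|] := boolP [forall i, 0 <= lform G x (a i)]; first by exists [::].
rewrite negb_forall => /existsP[i]; rewrite -ltNge => xi.
have [|s sP] := IH _ (Xr x i Xx).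
  by have := mr x i Xx xi; move: mN; rewrite -natr1; lra.
by exists (rcons s i) => j; rewrite /word foldr_rcons; exact: sP.
Qed.

End Words.
End Form.

(** * Simply laced Coxeter groups and the orbits of dominant vectors *)

Section Coxeter.
Variables (R : realType) (n : nat) (adj : rel 'I_n).
Hypothesis adjC : symmetric adj.
Let G := coxeter_gram R adj.
Implicit Types (v x y z : 'rV[R]_n) (i j : 'I_n).
Local Notation b := (@basis_vec R n).
Local Notation r i := (reflection G (b i)).

Lemma coxeter_gram_sym : G^T = G.
Proof. by apply/matrixP => i j; rewrite !mxE eq_sym adjC. Qed.

Lemma root_basis_vec i : root_vector G (b i).
Proof. by rewrite /root_vector lform_basis_vec mxE eqxx. Qed.

Lemma simple_reflectionE i x : r i x = x + lform G x (b i) *: b i.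
Proof. by rewrite reflectionE //; [exact: coxeter_gram_sym|exact: root_basis_vec]. Qed.

Lemma lform_simple_reflection i j x :
  lform G (r i x) (b j) = lform G x (b j) + lform G x (b i) * G i j.
Proof. by rewrite simple_reflectionE lformDl lformZl lform_basis_vec. Qed.

Lemma simple_reflectionK i : involutive (r i).
Proof. by apply: reflectionK; [exact: coxeter_gram_sym|exact: root_basis_vec]. Qed.

Lemma simple_reflection_comm i j x : G i j = 0 -> r i (r j x) = r j (r i x).
Proof.
move=> Gij; have Gji : G j i = 0 by rewrite -coxeter_gram_sym mxE.
rewrite ![r i _]simple_reflectionE ![r j _]simple_reflectionE.
rewrite !(lformDl, lformZl) !lform_basis_vec Gij Gji.
by apply/rowP => k; rewrite !mxE; ring.
Qed.

Lemma simple_reflection_braid i j x : i != j -> G i j = 1 ->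
  r i (r j (r i x)) = r j (r i (r j x)).
Proof.
move=> ij Gij; have Gji : G j i = 1 by rewrite -coxeter_gram_sym mxE.
have [Gii Gjj] : G i i = -2 /\ G j j = -2 by rewrite !mxE !eqxx.
rewrite ![r i _]simple_reflectionE ![r j _]simple_reflectionE.
rewrite !(lformDl, lformZl) !lform_basis_vec Gij Gji Gii Gjj.
apply/rowP => k; rewrite !mxE.
by move: (_ == _)%:R (_ == _)%:R => u w; ring.
Qed.

Definition dominant v := forall i, 0 <= lform G v (b i).

(** The step count drives the strong induction in [ascends_descent]. *)
Inductive ascends v : nat -> 'rV[R]_n -> Prop :=
| ascends_refl : ascends v 0 v
| ascends_step m x i : ascends v m x -> 0 < lform G x (b i) ->
    ascends v m.+1 (r i x).

(* The overlap of the last ascent with a descent is resolved by the commutation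
   and braid relations. *)
Lemma ascends_descent v : dominant v ->
  forall m x i, ascends v m x -> lform G x (b i) < 0 ->
    exists2 m', m = m'.+1 & ascends v m' (r i x).
Proof.
move=> dv; elim/ltn_ind=> m IH x i xm xi.
case: xm IH xi => [|{}m y j ym yj] IH xi.
  by move: (dv i); rewrite leNgt xi.
exists m => //.
have [<-|ji] := eqVneq j i; first by rewrite simple_reflectionK.
have : G j i = 0 \/ G j i = 1.
  by rewrite mxE (negPf ji); case: adj; [right|left].
move: xi; rewrite lform_simple_reflection => xi [] Gji; rewrite Gji in xi.
  have [|m' Em ym'] := IH m (ltnSn m) y i ym; first by lra.
  rewrite -simple_reflection_comm // Em; apply: ascends_step => //.
  rewrite lform_simple_reflection -/G.
  have -> : G i j = 0 by rewrite -coxeter_gram_sym mxE.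
  by lra.
have Gij : G i j = 1 by rewrite -coxeter_gram_sym mxE.
have [|m1 Em1 zm1] := IH m (ltnSn m) y i ym; first by lra.
have [||m2 Em2 tm2] := IH m1 _ (r i y) j zm1; first by rewrite Em1.
  by rewrite lform_simple_reflection Gij; lra.
(* The vector [r j (r i y)] is reached in [m2] steps. By the braid relation two ascents, along [i]
   and then [j], lead from it to the target. *)
have -> : r i (r j y) = r j (r i (r j (r i y))).
  by rewrite -simple_reflection_braid // 1?eq_sym // simple_reflectionK.
rewrite Em1 Em2; have [Gii Gjj] : G i i = -2 /\ G j j = -2 by rewrite !mxE !eqxx.
apply: ascends_step; first apply: ascends_step => //.
  by rewrite !lform_simple_reflection Gii Gij Gji; lra.
by rewrite !lform_simple_reflection Gii Gij Gji Gjj; lra.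
Qed.

(** A further simple reflection ascends, descends to a vector covered by [ascends_descent], or fixes
    the vector. *)
Lemma word_ascends v s : dominant v -> exists m, ascends v m (word G b s v).
Proof.
move=> dv; elim: s => [|i s [m sm]] /=; first by exists 0; exact: ascends_refl.
have [xi|xi|xi] := ltrgt0P (lform G (word G b s v) (b i)).
- by exists m.+1; apply: ascends_step.
- by have [m' _ ?] := ascends_descent dv sm xi; exists m'.
- by exists m; rewrite simple_reflectionE xi scale0r addr0.
Qed.

(** Induction along ascents only. The points are written as words so that they are known to lie in
    the orbit. *)
Lemma orbit_ind v (Q : 'rV[R]_n -> Prop) : dominant v -> Q v ->
  (forall s i, let x := word G b s v in
     Q x -> 0 < lform G x (b i) -> Q (r i x)) ->
  forall s, Q (word G b s v).
Proof.
move=> dv Qv Qr s; have [m] := word_ascends s dv.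
move: (word _ _ s v) => x xm; clear s.
suff [s <-] : exists2 s, word G b s v = x & Q (word G b s v) by [].
elim: xm => [|{}m {}x i _ [s <- Qs] xi]; first by exists [::].
by exists (i :: s) => //=; exact: Qr.
Qed.

Lemma reflection_group_word g : reflection_group G g ->
  exists s, g =1 word G b s.
Proof.
elim=> [_ [i _ <-]| |f h _ [s sf] _ [t th]|f h _ [s sf] fh hf].
- by exists [:: i].
- by exists [::].
- by exists (s ++ t) => x; rewrite /word foldr_cat /= th sf.
exists (rev s) => x; rewrite -{2}[x]hf sf wordK //.
- exact: coxeter_gram_sym.
- exact: root_basis_vec.
Qed.

Lemma word_reflection_group s : reflection_group G (word G b s).
Proof.
elim: s => [|i s IH]; first exact: generated_id.
apply: (@generated_comp _ _ (r i) (word G b s)) => //.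
by apply: generated_gen; exists i.
Qed.

Lemma orbit_of_word A x : orbit_of (reflection_group G) A x <->
  exists s v, A v /\ x = word G b s v.
Proof.
split=> [[g [v [/reflection_group_word[s gs] Av ->]]]|[s [v [Av ->]]]].
  by exists s, v; rewrite gs.
by exists (word G b s), v; split=> //; exact: word_reflection_group.
Qed.

End Coxeter.

(** * Coxeter orbits in integer coordinates, for evaluation by computation *)

Lemma foldr_add_sum (F : nat -> int) r :
  foldr (fun k x => F k + x) 0 r = \sum_(k <- r) F k.
Proof. by elim: r => [|k r IH]; rewrite ?big_nil // big_cons -IH. Qed.

Section IntegerVectors.
Variables (R : realType) (n : nat) (adj : rel nat).
Hypothesis adjC : symmetric adj.
Let G := coxeter_gram R [rel i j : 'I_n | adj i j].
Local Notation b := (@basis_vec R n).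

Lemma ord_adjC : symmetric [rel i j : 'I_n | adj i j].
Proof. by move=> i j; exact: adjC. Qed.

Definition int_vec (s : seq int) : 'rV[R]_n := \row_i (s`_i)%:~R.

(* Folds instead of big operators, so that the kernel can evaluate the form. *)
Definition int_form (s t : seq int) : int :=
  foldr (fun i x => foldr (fun j y =>
    s`_i * (if i == j then -2 else Posz (adj i j)) * t`_j + y)
    0 (iota 0 n) + x) 0 (iota 0 n).

Definition int_unit i : seq int := mkseq (fun k => Posz (k == i)) n.

Definition int_reflection (s : seq int) i : seq int :=
  let c := int_form s (int_unit i) in mkseq (fun k => s`_k + c * (k == i)%:Z) n.

Lemma lform_int_vec s t :
  lform G (int_vec s) (int_vec t) = (int_form s t)%:~R.
Proof.
pose g i j : int := if i == j then -2 else Posz (adj i j).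
have -> : int_form s t = \sum_(i < n) \sum_(j < n) s`_i * g i j * t`_j.
  rewrite /int_form foldr_add_sum -[X in iota 0 X]subn0 -/(index_iota 0 n) big_mkord.
  by apply: eq_bigr => i _; rewrite foldr_add_sum big_mkord.
rewrite rmorph_sum /lform mxE /=.
under [RHS]eq_bigr do rewrite rmorph_sum /=.
rewrite [RHS]exchange_big /=; apply: eq_bigr => j _; rewrite !mxE mulr_suml.
apply: eq_bigr => i _; rewrite !mxE !rmorphM /= -val_eqE; congr (_ * _ * _).
by rewrite /g /=; case: ifP.
Qed.

Lemma basis_vecE (i : 'I_n) : b i = int_vec (int_unit i).
Proof. by apply/rowP => j; rewrite !mxE nth_mkseq. Qed.

Lemma simple_reflection_int_vec (i : 'I_n) s :
  reflection G (b i) (int_vec s) = int_vec (int_reflection s i).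
Proof.
rewrite (simple_reflectionE ord_adjC) basis_vecE lform_int_vec.
apply/rowP => j; rewrite !mxE !nth_mkseq //.
by rewrite rmorphD rmorphM.
Qed.

Lemma word_int_vec (w : seq 'I_n) s :
  word G b w (int_vec s) = int_vec (foldr (fun i t => int_reflection t i) s (map val w)).
Proof. by elim: w => //= i w ->; rewrite simple_reflection_int_vec. Qed.

(** The neighbours of [L] outside [L]. Listing ascents only is enough, by [orbit_ind]. *)
Definition int_exits (L : seq (seq int)) : seq (seq int) :=
  [seq int_reflection l i | l <- L,
     i <- [seq i <- iota 0 n | (0 < int_form l (int_unit i)) &&
                               (int_reflection l i \notin L)]].

(* The witness e is the first point outside L along a sequence of ascents from v. *)
Lemma orbit_exit v L p :
  dominant [rel i j : 'I_n | adj i j] (int_vec v) -> v \in L ->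
  dominant [rel i j : 'I_n | adj i j] p ->
  forall s, let x := word G b s (int_vec v) in
  x \in map int_vec L \/
  exists e, [/\ e \in int_exits L, int_vec e \notin map int_vec L &
    lform G p (int_vec e) <= lform G p x].
Proof.
move=> dv vL dp; 
pose Q x := x \in map int_vec L \/ exists e, [/\ e \in int_exits L,
  int_vec e \notin map int_vec L & lform G p (int_vec e) <= lform G p x].
apply: (@orbit_ind _ _ _ ord_adjC _ Q) => //; first by left; exact: map_f.
move=> s i; move: (word _ _ s _) => /= x Qx xi.
have [rL|rL] := boolP (reflection G (b i) x \in map int_vec L); first by left.
right; case: Qx => [/mapP[l lL xl]|[e [eL eL' ep]]].
  rewrite xl simple_reflection_int_vec in rL *.
  exists (int_reflection l i); split=> //; apply/allpairsPdep.
  exists l, (i : nat); split=> //; rewrite mem_filter mem_iota ltn_ord.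
  move: xi; rewrite xl basis_vecE lform_int_vec ltr0z => -> /=.
  by rewrite andbT; apply: contra rL => /(map_f int_vec).
(* The old witness is kept: an ascent adds a positive multiple of a simple root, on which [p] is
   nonnegative. *)
exists e; split=> //; apply: le_trans ep _.
by rewrite (simple_reflectionE ord_adjC) lformDr lformZr lerDl mulr_ge0 // ltW.
Qed.
End IntegerVectors.

(** * The packing [P_beta] *)

Lemma edge_relC E : symmetric (edge_rel E).
Proof. by move=> i j; exact: orbC. Qed.

Lemma int_lt0 (R : realType) (x : R) : x \is a Num.int -> x < 0 -> x <= -1.
Proof. by move=> /intrP[z ->]; rewrite ltrz0 -[-1]/((-1)%:~R) ler_int; case: z. Qed.

(** Half of the last row of [beta_dual_entries]. *)
Definition nu_coords : seq int := [:: 2; 1; 2; 3; 4; 3; 2; 1; 0; -1].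

Local Notation beta_adj := [rel i j : 'I_10 | edge_rel beta_edges i j].
Local Notation beta_exits := (int_exits 10 (edge_rel beta_edges)).
Local Notation beta_int_form := (int_form 10 (edge_rel beta_edges)).

Definition tangent_exits (L : seq (seq int)) : seq (seq int) :=
  [seq e <- beta_exits L | all (fun l => beta_int_form e l == 2) L].

(** One round of an exhaustive search: every partial cluster is enlarged in every way by a neighbour
    tangent to all its members. *)
Definition cluster_step (Ls : seq (seq (seq int))) : seq (seq (seq int)) :=
  [seq e :: L | L <- Ls, e <- tangent_exits L].


Section Beta.
Variable R : realType.
Local Notation G := (beta_gram R).
Local Notation b := (@basis_vec R 10).
Local Notation vec := (@int_vec R 10).
Local Notation P := (P_beta R).

Lemma nuE : nu R = vec nu_coords.
Proof.
have [_ GV] := beta_gram_inv R; apply/rowP => i; rewrite !mxE GV !mxE.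
have -> : (nth [::] beta_dual_entries (@ord_max 9))`_i = 2 * nu_coords`_i.
  by case: i => -[|[|[|[|[|[|[|[|[|[|i]]]]]]]]]].
by rewrite rmorphM /=; field.
Qed.

Lemma beta_gram_sym : G^T = G.
Proof. exact/coxeter_gram_sym/ord_adjC/edge_relC. Qed.

Lemma root_beta i : root_vector G (b i).
Proof. exact: root_basis_vec. Qed.

Lemma lform_beta s t : lform G (vec s) (vec t) = (beta_int_form s t)%:~R.
Proof. exact: lform_int_vec. Qed.

Lemma dominant_nu : dominant beta_adj (nu R).
Proof.
move=> i; rewrite nuE basis_vecE lform_int_vec ler0z.
by case: i => -[|[|[|[|[|[|[|[|[|[|i]]]]]]]]]].
Qed.

Lemma P_betaP x : P x <-> exists s, x = word G b s (nu R).
Proof.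
rewrite /P_beta orbit_of_word; last exact/ord_adjC/edge_relC.
by split=> [[s [_ [-> ->]]]|[s ->]]; [exists s|exists s, (nu R)].
Qed.

Lemma P_beta_word s x : P x -> P (word G b s x).
Proof.
by move=> /P_betaP[t ->]; apply/P_betaP; exists (s ++ t); rewrite /word foldr_cat.
Qed.

Lemma P_beta_nu : P (nu R).
Proof. by apply/P_betaP; exists [::]. Qed.

Lemma P_beta_int x : P x -> exists s, x = vec s.
Proof.
move=> /P_betaP[s ->]; rewrite nuE.
by eexists; apply: word_int_vec; exact: edge_relC.
Qed.

Lemma P_beta_exit L p x : nu_coords \in L -> dominant beta_adj p -> P x ->
  x \in map vec L \/
  exists e, [/\ e \in beta_exits L, vec e \notin map vec L &
    lform G p (vec e) <= lform G p x].
Proof.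
move=> nuL dp /P_betaP[s ->]; rewrite nuE; apply: orbit_exit => //.
  exact: edge_relC.
by rewrite -nuE; exact: dominant_nu.
Qed.

(** Ascents from [nu] add positive multiples of simple roots, on which [p] is nonnegative. *)
Lemma P_beta_ge_nu p x : dominant beta_adj p -> P x ->
  lform G p (nu R) <= lform G p x.
Proof.
move=> dp /P_betaP[s ->].
apply: (@orbit_ind _ _ _ _ _ (fun x => lform G p (nu R) <= lform G p x)) => //.
- exact/ord_adjC/edge_relC.
- exact: dominant_nu.
move=> {}s i /= sP si; apply: le_trans sP _.
rewrite simple_reflectionE; last exact/ord_adjC/edge_relC.
by rewrite lformDr lformZr lerDl mulr_ge0 // ltW.
Qed.

Lemma lform_P_beta_norm x : P x -> lform G x x = -2.
Proof.
move=> /P_betaP[s ->]; rewrite lform_word.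
- by rewrite nuE lform_beta.
- exact: beta_gram_sym.
- exact: root_beta.
Qed.

(** The group moves [y] to [nu]. The only neighbour of [nu] is nu + 2 beta_9, and its product with
    [nu] is -2 + 4 = 2. *)
Lemma P_beta_packing x y : P x -> P y -> x != y -> 2 <= lform G x y.
Proof.
move=> Px /P_betaP[s ->] xy.
have Wx : word G b s (word G b (rev s) x) = x.
  by rewrite wordVK //; [exact: beta_gram_sym|exact: root_beta].
rewrite -Wx lform_word; [|exact: beta_gram_sym|exact: root_beta].
rewrite lformC; last exact: beta_gram_sym.
have /(P_beta_exit (mem_head _ [::]) dominant_nu) : P (word G b (rev s) x).
  exact: P_beta_word.
case=> [|[e []]].
  by rewrite inE nuE => /eqP E; rewrite -Wx E nuE eqxx in xy.
have -> : beta_exits [:: nu_coords] = [:: [:: 2; 1; 2; 3; 4; 3; 2; 1; 0; 1]].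
  by vm_compute.
by rewrite inE => /eqP-> _; rewrite nuE lform_beta.
Qed.

End Beta.

(** * Normal form of a cluster of ten mutually tangent spheres *)

Section Cluster.
Variable R : realType.
Local Notation G := (beta_gram R).
Local Notation b := (@basis_vec R 10).
Local Notation vec := (@int_vec R 10).
Local Notation P := (P_beta R).

Section Dominant.
Variables (d : 'I_10 -> 'rV[R]_10) (k : 'I_10).
Hypotheses (dP : forall i, P (d i)) (dT : pairwise_tangent G d).
(* The weight of d k makes it the member of the cluster lowest with respect
   to p, hence equal to nu. *)
Let p := \sum_i d i + d k.
Hypothesis dp : dominant beta_adj p.

(** The sum contributes -2 + 9 * 2 = 16, and the extra [d k] adds -2 or 2. *)
Lemma lform_cluster_sum i : lform G p (d i) = if i == k then 14 else 18.
Proof.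
have di j : lform G (d j) (d i) = if j == i then -2 else 2.
  by case: eqVneq => [->|/dT.2 //]; exact: lform_P_beta_norm.
rewrite /p lformDl lform_suml (bigD1 i) //= !di eqxx eq_sym.
rewrite (eq_bigr (fun=> 2)) => [|j /negPf]; last by rewrite di => ->.
by rewrite sumr_const cardC1 card_ord -mulr_natl /=; case: ifP => _; ring.
Qed.

(** Outside the cluster each of the eleven summands of [p] contributes at least 2. *)
Lemma cluster_near x : P x -> lform G p x < 22 -> exists i, d i = x.
Proof.
move=> Px; apply: contraPP => /forallNP nx.
have dx i : 2 <= lform G (d i) x.
  by apply: P_beta_packing => //; apply/eqP/nx.
apply/negP; rewrite -leNgt /p lformDl lform_suml.
have -> : 22 = (\sum_(i < 10) 2) + 2 :> R.
  by rewrite sumr_const card_ord -mulr_natl; ring.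
by apply: lerD => //; apply: ler_sum.
Qed.

(** [nu] minimises the product with the dominant [p], so its value is at most 14, which within the
    cluster only [d k] attains. *)
Lemma dominant_cluster_nu : d k = nu R.
Proof.
have nuk : lform G p (nu R) <= 14.
  by have := P_beta_ge_nu dp (dP k); rewrite lform_cluster_sum eqxx.
have [|i di] := cluster_near (P_beta_nu R); first by lra.
by move: nuk; rewrite -di lform_cluster_sum; case: eqP => [->|_] //; rewrite ler_nat.
Qed.

(** By counting, some [d i] lies outside [L]. Its value is at most 18, so the exit from [L] below it
    has value under 22 and belongs to the cluster. *)
Lemma dominant_cluster_extend L : nu_coords \in L -> (size L < 10)%N ->
  (forall l, l \in L -> exists i, d i = vec l) ->
  exists2 e, e \in tangent_exits L & exists i, d i = vec e.
Proof.
move=> nuL sL LP.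
have [i /negP iL] : exists i, ~ (d i \in map vec L).
  apply/not_existsP => dL; move: sL; rewrite ltnNge -(size_map vec).
  have sdL : {subset codom d <= map vec L} by move=> _ /codomP[i ->]; exact: contrapT.
  have := uniq_leq_size _ sdL; rewrite size_codom card_ord => -> //.
  by apply/injectiveP; exact: dT.1.
have [|[e [eL eL' ei]]] := P_beta_exit nuL dp (dP i); first by rewrite (negPf iL).
have Pe : P (vec e).
  case/allpairsPdep: (eL) => l [j [lL]]; rewrite mem_filter mem_iota /= => /andP[_ j10] ->.
  have [m dm] := LP l lL; have := @P_beta_word R [:: Ordinal j10] _ (dP m).
  by rewrite dm /= simple_reflection_int_vec //; exact: edge_relC.
have [|m dm] := cluster_near Pe.
  by have := lform_cluster_sum i; case: ifP => _; lra.
exists e; last by exists m.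
rewrite mem_filter eL andbT; apply/allP => l lL; have [m' dm'] := LP l lL.
rewrite -(eqr_int R) -lform_beta -dm -dm'; apply/eqP/dT.2.
by apply: contraNneq eL' => mm'; rewrite -dm mm' dm' map_f.
Qed.

Lemma dominant_cluster_steps m : (m <= 9)%N ->
  exists2 L, L \in iter m cluster_step [:: [:: nu_coords]] &
    [/\ nu_coords \in L, size L = m.+1 &
        forall l, l \in L -> exists i, d i = vec l].
Proof.
elim: m => [_|m IH m9].
  exists [:: nu_coords]; rewrite ?mem_head //; split=> // l.
  by rewrite inE => /eqP->; exists k; rewrite dominant_cluster_nu nuE.
have [L LL [nuL sL LP]] := IH (ltnW m9).
have [|e eL ed] := dominant_cluster_extend nuL _ LP; first by rewrite sL.
exists (e :: L); first by apply/allpairsPdep; exists L, e.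
split=> [||l]; rewrite ?inE ?nuL ?orbT //= ?sL //.
by case/predU1P=> [->|/LP].
Qed.

End Dominant.

(** The Weyl vector, used as a height: on integral vectors a simple reflection with negative product
    lowers it by at least 1. *)
Definition rho : 'rV[R]_10 := \sum_i weight G i.

Lemma lform_rho i : lform G rho (b i) = 1.
Proof.
have [Gu _] := beta_gram_inv R.
rewrite lform_suml (bigD1 i) //= form_weight // eqxx big1 ?addr0 // => j ji.
by rewrite form_weight // (negPf ji).
Qed.

Lemma dominant_rho : dominant beta_adj rho.
Proof. by move=> i; rewrite lform_rho. Qed.

Lemma lform_int_basis_vec s i : lform G (vec s) (b i) \is a Num.int.
Proof.
by rewrite basis_vecE lform_int_vec intr_int.
Qed.

(** Descent by height: each of the eleven summands stays in [P_beta], where [nu] has least height,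
    so the height of the sum is bounded below. *)
Lemma cluster_descent (c : 'I_10 -> 'rV[R]_10) k : (forall i, P (c i)) ->
  exists s, dominant beta_adj (\sum_i word G b s (c i) + word G b s (c k)).
Proof.
move=> cP; pose p0 := \sum_i c i + c k.
have wp s : word G b s p0 = \sum_i word G b s (c i) + word G b s (c k).
  have [T sT] := word_mulmx (beta_gram_sym R) b s.
  by rewrite !sT mulmxDl mulmx_suml; under [in RHS]eq_bigr do rewrite sT.
pose nr := lform G rho (nu R).
have nr_le s i : nr <= lform G rho (word G b s (c i)).
  by apply: P_beta_ge_nu dominant_rho _; exact: P_beta_word.
have [s sP] : exists s, forall i, 0 <= lform G (word G b s p0) (b i).
  apply: (descent (X := fun x => exists s, x = word G b s p0)
    (m := lform G rho) (b := nr *+ 10 + nr)).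
  - move=> _ [s ->]; rewrite wp lformDr lform_sumr lerD //.
    have -> : nr *+ 10 = \sum_(i < 10) nr by rewrite sumr_const card_ord.
    exact: ler_sum.
  - by move=> _ i [s ->]; exists (i :: s).
  - move=> _ i [s ->] si.
    rewrite simple_reflectionE; last exact/ord_adjC/edge_relC.
    rewrite lformDr lformZr lform_rho mulr1 lerD2l; apply: int_lt0 => //.
    rewrite wp lformDl lform_suml rpredD ?rpred_sum // => [j _|].
      by have [t ->] := P_beta_int (P_beta_word s (cP j)); exact: lform_int_basis_vec.
    by have [t ->] := P_beta_int (P_beta_word s (cP k)); exact: lform_int_basis_vec.
  - by exists [::].
by exists s => i; rewrite -wp.
Qed.

(* Orthogonal to base_cluster: twice the difference of the weight of beta_0 and
   nu. *)
Definition base_h : seq int := [:: 1; 1; 2; 3; 4; 4; 4; 4; 4; 4].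

(* The vectors e_1, ..., e_9, where e_10 = nu and e_i = e_(i+1) + 2 beta_i. *)
Definition base_cluster : seq (seq int) := [::
  [:: 2; 3; 4; 5; 6; 5; 4; 3; 2; 1]; [:: 2; 1; 4; 5; 6; 5; 4; 3; 2; 1];
  [:: 2; 1; 2; 5; 6; 5; 4; 3; 2; 1]; [:: 2; 1; 2; 3; 6; 5; 4; 3; 2; 1];
  [:: 2; 1; 2; 3; 4; 5; 4; 3; 2; 1]; [:: 2; 1; 2; 3; 4; 3; 4; 3; 2; 1];
  [:: 2; 1; 2; 3; 4; 3; 2; 3; 2; 1]; [:: 2; 1; 2; 3; 4; 3; 2; 1; 2; 1];
  [:: 2; 1; 2; 3; 4; 3; 2; 1; 0; 1]].

(** Doubling the member [k] sends it to [nu], so the nine others account for [base_cluster]. *)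
Lemma cluster_normal_form (c : 'I_10 -> 'rV[R]_10) k :
  (forall i, P (c i)) -> pairwise_tangent G c ->
  exists s, forall l, l \in base_cluster ->
    exists2 i, i != k & word G b s (c i) = vec l.
Proof.
move=> cP [c_inj cT]; have [s sP] := cluster_descent k cP; exists s.
pose d i := word G b s (c i).
have dT : pairwise_tangent G d.
  have wI := can_inj (wordK (beta_gram_sym R) (@root_beta R) s).
  split=> [i j /wI/c_inj //|i j ij].
  by rewrite lform_word; [exact: cT|exact: beta_gram_sym|exact: root_beta].
have dP i : P (d i) by exact: P_beta_word.
have [L] := dominant_cluster_steps dP dT sP (leqnn 9).
(* The search has a single outcome, so the whole cluster is determined. *)
have -> : iter 9 cluster_step [:: [:: nu_coords]] =
    [:: rcons base_cluster nu_coords] by vm_compute.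
rewrite inE => /eqP-> [_ _ LP] l lB.
have [|i di] := LP l; first by rewrite mem_rcons inE lB orbT.
(* The member [k] is [nu], and [l] differs from [nu] since its product with [nu] is not -2. *)
exists i => //; apply/eqP => ik; have := dominant_cluster_nu dP dT sP.
rewrite -ik di nuE => lnu; have := lform_beta R l nu_coords.
rewrite lnu lform_beta => /esym/eqP; rewrite eqr_int.
by have /allP/(_ _ lB)/negPf-> : all (fun l => beta_int_form l nu_coords !=
  beta_int_form nu_coords nu_coords) base_cluster by vm_compute.
Qed.

End Cluster.

(** * Projections, cross sections and isometric embeddings *)

Section Projection.
Variables (R : realType) (n : nat) (G : 'M[R]_n).
Hypothesis Gs : G^T = G.
Implicit Types (h x y : 'rV[R]_n).

Lemma projectionZ t h x : t != 0 -> projection G (t *: h) x = projection G h x.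
Proof.
move=> t0; rewrite /projection !lformZl !lformZr scalerA; congr (x - _ *: h).
(* For isotropic [h] both quotients are 0, as the inverse of 0 is 0. *)
have [->|h0] := eqVneq (lform G h h) 0; first by rewrite !mulr0 invr0 !mulr0 mul0r.
by field; rewrite h0.
Qed.

Lemma cross_sectionZ P t h : t != 0 ->
  cross_section G P (t *: h) = cross_section G P h.
Proof.
move=> t0; rewrite /cross_section; congr (rays _); apply/seteqP.
by split=> y [yy [x Px yx]]; split=> //; exists x => //; rewrite yx projectionZ.
Qed.

Lemma lform_projection h x y : lform G h h != 0 ->
  lform G (projection G h x) (projection G h y) =
  lform G x y - lform G x h * lform G y h / lform G h h.
Proof.
move=> h0; rewrite /projection -!scaleNr !(lformDl, lformDr, lformZl, lformZr).
by rewrite [lform G h y]lformC //; field.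
Qed.

Lemma lform_projection_orthogonal h x y : lform G h y = 0 ->
  lform G (projection G h x) y = lform G x y.
Proof. by move=> hy; rewrite /projection -scaleNr lformDl lformZl hy mulr0 addr0. Qed.

Lemma projection_orthogonal h x : lform G h h != 0 ->
  lform G h (projection G h x) = 0.
Proof.
move=> h0; rewrite /projection -scaleNr lformDr lformZr [lform G h x]lformC //.
by field.
Qed.

Variables (I : finType) (a : I -> 'rV[R]_n).
Hypothesis ra : forall i, root_vector G (a i).

Lemma projection_word s h x :
  projection G (word G a s h) (word G a s x) = word G a s (projection G h x).
Proof.
have [T sT] := word_mulmx Gs a s.
by rewrite /projection !lform_word // !sT mulmxBl scalemxAl.
Qed.

Lemma cross_section_word P s h : (forall t x, P x -> P (word G a t x)) ->
  cross_section G P h =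
  word G a (rev s) @` cross_section G P (word G a s h).
Proof.
move=> PW; apply/seteqP; split=> x.
  move=> [c [y [c0 [yy [z Pz Ey]] ->]]]; subst y; exists (word G a s (c *: projection G h z)).
    exists c, (word G a s (projection G h z)); rewrite (wordZ Gs); split=> //; split.
      by rewrite lform_word.
    by exists (word G a s z); [exact: PW|rewrite projection_word].
  exact: wordK.
move=> [_ [c [y [c0 [yy [z Pz Ey]] ->]]] <-]; subst y.
exists c, (word G a (rev s) (projection G (word G a s h) z)); rewrite (wordZ Gs).
split=> //; split; first by rewrite lform_word.
exists (word G a (rev s) z); first exact: PW.
by rewrite -projection_word wordK.
Qed.

Lemma word_fixed s h : (forall i, lform G h (a i) = 0) -> word G a s h = h.
Proof.
by move=> ha; elim: s => //= i s ->; rewrite reflectionE // ha scale0r addr0.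
Qed.

End Projection.

Section IsometricEmbedding.
Variables (R : realType) (m n : nat) (G : 'M[R]_n) (K : 'M[R]_m) (A : 'M[R]_(m, n)).
Hypotheses (Gs : G^T = G) (Ks : K^T = K) (AG : A *m G *m A^T = K).

Lemma lform_mulmx x y : lform G (x *m A) (y *m A) = lform K x y.
Proof. by rewrite /lform -AG trmx_mul !mulmxA. Qed.

Lemma reflection_mulmx_isometry v x :
  reflection G (v *m A) (x *m A) = reflection K v x *m A.
Proof. by rewrite /reflection !lform_mulmx mulmxBl scalemxAl. Qed.

Lemma word_mulmx_isometry (I : finType) (a : I -> 'rV[R]_m) s x :
  word G (fun i => a i *m A) s (x *m A) = word K a s x *m A.
Proof. by elim: s => //= i s ->; rewrite reflection_mulmx_isometry. Qed.

End IsometricEmbedding.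

(** The rows of [A] lie in the hyperplane, and [A] has full rank because its Gram matrix [K] is
    invertible. The hyperplane has dimension [n] as [h] is nonzero, so the rows span it. *)
Lemma isometry_onto_hyperplane (R : realType) (n : nat) (G : 'M[R]_n.+1)
    (K : 'M[R]_n) (A : 'M[R]_(n, n.+1)) h :
  G \in unitmx -> G^T = G -> K \in unitmx -> A *m G *m A^T = K -> h != 0 ->
  (forall i, lform G h (row i A) = 0) ->
  isometry_onto K G (mulmxr A) (hyperplane G h).
Proof.
move=> Gu Gs Ku AG h0 hA; split; first by move=> x y; exact: lform_mulmx.
have AK : (A <= kermx (G *m h^T))%MS.
  apply/sub_kermxP/matrixP => i j; rewrite [j]ord1 mulmxA [RHS]mxE -(hA i) lformC //.
  by rewrite /lform -row_mul !mxE; apply: eq_bigr => k _; rewrite !mxE.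
have KA : (kermx (G *m h^T) <= A)%MS.
  rewrite -(geq_leqif (mxrank_leqif_sup AK)) mxrank_ker.
  have /eqP-> : row_free A.
    by apply/row_freeP; exists (G *m A^T *m invmx K); rewrite !mulmxA AG mulmxV.
  rewrite leq_subLR; apply: (leq_add (m1 := 1) _ (leqnn n)); rewrite lt0n mxrank_eq0.
  apply: contraNneq h0 => Gh; rewrite -[h]trmxK -[h^T](mulKmx Gu) Gh mulmx0.
  by rewrite trmx0.
apply/seteqP; split=> x; rewrite /hyperplane /=.
  move=> [z _ <-]; rewrite lformC // /lform.
  by move/sub_kermxP: (submx_trans (submxMl z A) AK); rewrite mulmxA => ->; rewrite mxE.
move=> hx; have /submxP[z ->] : (x <= A)%MS; last by exists z.
apply: submx_trans KA; apply/sub_kermxP; apply/matrixP => i j.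
by rewrite !ord1 mulmxA [RHS]mxE -hx lformC.
Qed.

(** * The cross section for the base cluster, and its transport to any cluster *)

Lemma ordinals_of_nats n (w : seq nat) : all (fun i => (i < n)%N) w ->
  exists s : seq 'I_n, map val s = w.
Proof.
elim: w => [|i w IH] /=; first by exists [::].
by move=> /andP[i_n /IH[s <-]]; exists (Ordinal i_n :: s).
Qed.

Lemma cycle_tail_adjC :
  symmetric [rel i j : 'I_9 | edge_rel cycle_tail_edges i.+1 j.+1].
Proof. by move=> i j; exact: edge_relC. Qed.

Section BaseCrossSection.
Variable R : realType.
Local Notation G := (beta_gram R).
Local Notation K := (cycle_tail_gram R).
Local Notation b := (@basis_vec R 10).
Local Notation vec := (@int_vec R 10).
Local Notation P := (P_beta R).
Local Notation h := (vec base_h).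
Local Notation pr := (projection G (vec base_h)).
Local Notation wt := (weight K).

Lemma cycle_tail_gram_sym : K^T = K.
Proof. exact/coxeter_gram_sym/cycle_tail_adjC. Qed.

Lemma cycle_tail_unit : K \in unitmx.
Proof. exact: (cycle_tail_gram_inv R).1. Qed.

(* The index i stands for a_(i+1): a_1 = (e_7 + e_8 + e_9 - e_1) / 2 and
   a_(i+1) = beta_i for i > 0. *)
Definition cycle_root_coords i : seq int :=
  if i == 0%N then [:: 2; 0; 1; 2; 3; 2; 1; 1; 1; 1] else int_unit 10 i.

Definition cycle_root (i : 'I_9) : 'rV[R]_10 := vec (cycle_root_coords i).

Definition embedding_mx : 'M[R]_(9, 10) := \matrix_(i < 9) cycle_root i.
Local Notation A := embedding_mx.

Lemma cycle_rootE i : cycle_root i = basis_vec R i *m A.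
Proof. by rewrite -rowE rowK. Qed.

Lemma embedding_mxP : A *m G *m A^T = K.
Proof.
apply/matrixP => i j; rewrite -[LHS]lform_basis_vec.
transitivity (lform G (cycle_root i) (cycle_root j)).
  by rewrite !cycle_rootE /lform trmx_mul !mulmxA.
rewrite lform_beta mxE -val_eqE /=.
have : all (fun i => all (fun j =>
    beta_int_form (cycle_root_coords i) (cycle_root_coords j) ==
    (if i == j then -2 else Posz (edge_rel cycle_tail_edges i.+1 j.+1)))
  (iota 0 9)) (iota 0 9) by vm_compute.
move=> /allP/(_ i)/[!mem_iota]/(_ (ltn_ord i)).
move=> /allP/(_ j)/[!mem_iota]/(_ (ltn_ord j))/eqP->.
by case: ifP.
Qed.

Lemma root_cycle_root i : root_vector G (cycle_root i).
Proof.
rewrite /root_vector cycle_rootE (lform_mulmx embedding_mxP).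
exact/root_basis_vec.
Qed.

Lemma base_h_norm : lform G h h = -14.
Proof. by rewrite lform_beta. Qed.

Lemma base_h_norm_neq0 : lform G h h != 0.
Proof. by rewrite base_h_norm oppr_eq0 pnatr_eq0. Qed.

Lemma base_h_cycle_root i : lform G h (cycle_root i) = 0.
Proof.
rewrite lform_beta; have : all (fun i => beta_int_form base_h
  (cycle_root_coords i) == 0) (iota 0 9) by vm_compute.
by move=> /allP/(_ i)/[!mem_iota]/(_ (ltn_ord i))/eqP->.
Qed.

Lemma P_beta_int_word w : all (fun i => (i < 10)%N) w ->
  P (vec (foldr (fun i t => int_reflection 10 (edge_rel beta_edges) t i) nu_coords w)).
Proof.
move=> /ordinals_of_nats[s <-]; rewrite -(word_int_vec R (@edge_relC _)) -nuE.
by apply/P_betaP; exists s.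
Qed.

(** All the roots but a_1 are simple, and a_1 is a group image of beta_9, so its reflection is a
    conjugate of a simple one. *)
Lemma P_beta_cycle_reflection i x : P x -> P (reflection G (cycle_root i) x).
Proof.
move=> Px; have [i0|i0] := eqVneq (i : nat) 0%N; last first.
  have i10 : (i < 10)%N by apply: leq_trans (ltn_ord i) _.
  have -> : cycle_root i = b (Ordinal i10).
    by rewrite basis_vecE /cycle_root /cycle_root_coords (negPf i0).
  exact: (@P_beta_word R [:: Ordinal i10]).
(* This word was found by descending from a_1 to the simple root beta_9. *)
have [s sw] := @ordinals_of_nats 10 [:: 0; 4; 3; 2; 5; 4; 0; 3; 4; 5; 6; 7; 8]%N isT.
have -> : cycle_root i = word G b s (b ord_max).
  rewrite basis_vecE (word_int_vec R (@edge_relC _)) sw /cycle_root i0.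
  by congr int_vec; vm_compute.
rewrite reflection_word; last 1 [exact: root_beta].
- exact/P_beta_word/(@P_beta_word R [:: ord_max])/P_beta_word.
- exact: beta_gram_sym.
- exact: root_beta.
Qed.

Lemma P_beta_cycle_word s x : P x -> P (word G cycle_root s x).
Proof. by move=> Px; elim: s => //= i s; exact: P_beta_cycle_reflection. Qed.

Lemma isometry_onto_base : isometry_onto K G (mulmxr A) (hyperplane G h).
Proof.
apply: isometry_onto_hyperplane.
- exact: (beta_gram_inv R).1.
- exact: beta_gram_sym.
- exact: cycle_tail_unit.
- exact: embedding_mxP.
- by apply: contraNneq base_h_norm_neq0 => ->; rewrite lform0l.
- by move=> i; rewrite rowK base_h_cycle_root.
Qed.

Lemma lform_weight_coord (z : 'rV[R]_9) i : lform K z (wt i) = z 0 i.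
Proof.
rewrite lformC ?cycle_tail_gram_sym // lform_expandr (bigD1 i) //=.
rewrite form_weight ?cycle_tail_unit // eqxx mulr1 big1 ?addr0 // => j ji.
by rewrite form_weight ?cycle_tail_unit // eq_sym (negPf ji) mulr0.
Qed.

(** The coordinates are z = (z K) K^-1, and K^-1 has negative entries only in columns 3, 4 and 9. *)
Lemma coord_ge0 (z : 'rV[R]_9) (i : 'I_9) : i.+1 \notin [:: 3; 4; 9]%N ->
  (forall j, 0 <= lform K z (basis_vec R j)) -> 0 <= z 0 i.
Proof.
move=> i349 zP; have [Ku KV] := cycle_tail_gram_inv R.
rewrite -[z](mulmxK Ku) mxE sumr_ge0 // => j _.
rewrite -lform_basis_vecr mulr_ge0 // KV !mxE mulr_ge0 ?invr_ge0 ?ler0n // ler0z.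
have : all (fun i => (i.+1 \notin [:: 3; 4; 9]%N) ==> all (fun j =>
    0 <= (nth [::] cycle_tail_dual_entries j)`_i) (iota 0 9)) (iota 0 9).
  by vm_compute.
move=> /allP/(_ i)/[!mem_iota]/(_ (ltn_ord i))/implyP/(_ i349).
by move=> /allP/(_ j)/[!mem_iota]/(_ (ltn_ord j)).
Qed.

(* The elements of P_beta whose projections are 2 w_3, 2 w_4 and (in the default
   branch) 2 w_9; as in cycle_root_coords, the index i stands for i + 1. *)
Definition section_top i : seq int :=
  if i == 2%N then [:: 4; 1; 2; 5; 8; 7; 6; 5; 4; 3]
  else if i == 3%N then [:: 4; 1; 2; 3; 6; 5; 4; 3; 2; 1]
  else [:: 2; 1; 2; 3; 4; 3; 2; 1; 0; 1].

Lemma P_beta_section_top i : P (vec (section_top i)).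
Proof.
rewrite /section_top; case: ifP => _; [|case: ifP => _].
- exact: (@P_beta_int_word [:: 9; 8; 7; 6; 5; 4; 0; 3; 4; 5; 6; 7; 8; 9]%N isT).
- exact: (@P_beta_int_word [:: 0; 4; 5; 6; 7; 8; 9]%N isT).
- exact: (@P_beta_int_word [:: 9]%N isT).
Qed.

Lemma projection_embedding x : exists z, pr x = z *m A.
Proof.
have : hyperplane G h (pr x).
  by apply: projection_orthogonal; [exact: beta_gram_sym|exact: base_h_norm_neq0].
by rewrite -isometry_onto_base.2 => -[z _ <-]; exists z.
Qed.

Lemma lform_embedded_root z x i : pr x = z *m A ->
  lform K z (basis_vec R i) = lform G x (cycle_root i).
Proof.
move=> xz; rewrite -(lform_mulmx embedding_mxP) -xz -cycle_rootE.
by rewrite lform_projection_orthogonal // base_h_cycle_root.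
Qed.

Lemma projection_section_top (i : 'I_9) : i.+1 \in [:: 3; 4; 9]%N ->
  pr (vec (section_top i)) = (2 *: wt i) *m A.
Proof.
move=> i349; have [z zP] := projection_embedding (vec (section_top i)).
rewrite zP; congr (_ *m A); apply: (lform_nondegenerate cycle_tail_unit) => j.
rewrite (lform_embedded_root j zP) lformZl form_weight ?cycle_tail_unit //.
rewrite lform_beta -val_eqE /=.
have : all (fun i => (i.+1 \in [:: 3; 4; 9]%N) ==> all (fun j =>
    beta_int_form (section_top i) (cycle_root_coords j) ==
    if i == j then 2 else 0) (iota 0 9)) (iota 0 9) by vm_compute.
move=> /allP/(_ i)/[!mem_iota]/(_ (ltn_ord i))/implyP/(_ i349).
move=> /allP/(_ j)/[!mem_iota]/(_ (ltn_ord j))/eqP->.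
by case: ifP; rewrite ?mulr1 ?mulr0.
Qed.

Lemma dominant_section_top x : P x ->
  (forall i, 0 <= lform G x (cycle_root i)) -> lform G (pr x) (pr x) < 0 ->
  exists2 i : 'I_9, i.+1 \in [:: 3; 4; 9]%N & x = vec (section_top i).
Proof.
move=> Px xP xn; apply: contrapT => xtop.
have [z zP] := projection_embedding x.
move: (xn); rewrite zP (lform_mulmx embedding_mxP); apply/negP; rewrite -leNgt.
rewrite lform_expandr sumr_ge0 // => i _; apply: mulr_ge0; last first.
  by rewrite (lform_embedded_root i zP).
have [i349|i349] := boolP (i.+1 \in [:: 3; 4; 9]%N); last first.
  by apply: coord_ge0 => // j; rewrite (lform_embedded_root j zP).
have xi : 2 <= lform G x (vec (section_top i)).
  apply: P_beta_packing => //; first exact: P_beta_section_top.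
  by apply/eqP => xE; apply: xtop; exists i.
have iz : lform G (pr x) (pr (vec (section_top i))) = 2 * z 0 i.
  by rewrite projection_section_top // zP (lform_mulmx embedding_mxP) lformZr
    lform_weight_coord.
move: iz xn; rewrite !lform_projection ?base_h_norm_neq0 ?beta_gram_sym //.
rewrite base_h_norm lform_P_beta_norm // (lform_beta R (section_top i)).
set y := lform G x h; move: xi; set c := lform G x _; move=> xi iz yy.
(* Since h.h = -14, negative norm gives y^2 < 28. Moreover 2 z_i = c + y (n_i.h) / 14 with c >= 2
   and |n_i.h| <= 4, hence z_i > 0. *)
have : beta_int_form (section_top i) base_h \in [:: -4; 4; 0].
  by move: i349; rewrite !inE !eqSS => /or3P[] /eqP->; vm_compute.
by rewrite !inE => /or3P[] /eqP yi; rewrite yi in iz; nra.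
Qed.

(** The height [rho] works again: its product with a root is the sum of the coordinates, at least 1
    for each a_i. *)
Lemma cycle_descent x : P x ->
  exists s, forall i, 0 <= lform G (word G cycle_root s x) (cycle_root i).
Proof.
apply: (descent (m := lform G (rho R)) (b := lform G (rho R) (nu R))).
- by move=> {}x Px; apply: P_beta_ge_nu Px; exact: dominant_rho.
- by move=> {}x i; exact: P_beta_cycle_reflection.
move=> {}x i Px xi; rewrite reflectionE; last 2 first.
- exact: beta_gram_sym.
- exact: root_cycle_root.
rewrite lformDr lformZr lerD2l.
have x1 : lform G x (cycle_root i) <= -1.
  by apply: int_lt0 => //; have [s ->] := P_beta_int Px; rewrite lform_beta intr_int.
have r1 : 1 <= lform G (rho R) (cycle_root i).
  rewrite lform_expandr; under eq_bigr do rewrite lform_rho mulr1 mxE.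
  rewrite -rmorph_sum /= -(big_mkord xpredT (fun j => (cycle_root_coords i)`_j)).
  rewrite -foldr_add_sum -[1]/(1%:~R) ler_int.
  have : all (fun i => 1 <= foldr (fun k y => (cycle_root_coords i)`_k + y) 0
    (index_iota 0 10)) (iota 0 9) by vm_compute.
  by move=> /allP/(_ i)/[!mem_iota]/(_ (ltn_ord i)).
nra.
Qed.

(** Reflections in the a_i fix [h], so they commute with the projection, and [A] matches them with
    the simple reflections of [K]. Each orbit thus reduces to the three top elements. *)
Lemma cross_section_base :
  cross_section G P h = (mulmxr A) @` cycle_tail_packing R.
Proof.
have Ks := cycle_tail_gram_sym; have Gs := beta_gram_sym R.
have wordA s z : word G cycle_root s (z *m A) = word K (@basis_vec R 9) s z *m A.
  rewrite -(word_mulmx_isometry embedding_mxP).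
  by congr (word G _ s _); apply/funext => i; rewrite cycle_rootE.
have prW s x : pr (word G cycle_root s x) = word G cycle_root s (pr x).
  rewrite -projection_word //; last exact: root_cycle_root.
  by rewrite (word_fixed Gs root_cycle_root s base_h_cycle_root).
apply/seteqP; split=> x.
  move=> [c [y [c0 [yn [z Pz Ey]] ->]]]; subst y.
  have [s sP] := cycle_descent Pz.
  have [|i i349 zi] := dominant_section_top (P_beta_cycle_word s Pz) sP.
    by rewrite prW lform_word //; exact: root_cycle_root.
  have prz : pr z = (2 *: word K (@basis_vec R 9) (rev s) (wt i)) *m A.
    rewrite -[z](wordK Gs root_cycle_root s) zi prW projection_section_top //.
    by rewrite wordA wordZ.
  exists (c *: (2 *: word K (@basis_vec R 9) (rev s) (wt i))); last first.
    by rewrite prz /= scalemxAl.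
  exists (c * 2), (word K (@basis_vec R 9) (rev s) (wt i)); rewrite scalerA.
  split=> //; first by rewrite mulr_gt0.
  apply/orbit_of_word; first exact: cycle_tail_adjC.
  by exists (rev s), (wt i); split=> //; exists i.
move=> [_ [c [y [c0 yO ->]] <-]].
case/orbit_of_word: yO => [|s [_ [[i i349 <-] ->]]]; first exact: cycle_tail_adjC.
(* The top elements project to twice the weights. *)
exists (c / 2), (pr (word G cycle_root s (vec (section_top i)))).
have prs : pr (word G cycle_root s (vec (section_top i))) =
    (2 *: word K (@basis_vec R 9) s (wt i)) *m A.
  by rewrite prW projection_section_top // wordA wordZ.
split; first by rewrite divr_gt0.
- split; last first.
    by exists (word G cycle_root s (vec (section_top i))) => //;
      exact/P_beta_cycle_word/P_beta_section_top.
  rewrite prs (lform_mulmx embedding_mxP) lformZl lformZr !pmulr_rlt0 //.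
  by rewrite lform_word ?cycle_tail_weight_norm // => j; exact/root_basis_vec.
- by rewrite prs /= -!scalemxAl scalerA; congr (_ *: _); field.
Qed.

(** Such an [x] is orthogonal to all the a_i, hence its projection, which lies in their
    nondegenerate span, vanishes. *)
Lemma orthogonal_base_cluster x :
  (forall l, l \in base_cluster -> lform G x (vec l) = 0) ->
  exists t, x = t *: h.
Proof.
(* Coefficients in e_1, ..., e_9 of 2 a_1 = e_7 + e_8 + e_9 - e_1 and 2 beta_i = e_i - e_(i+1). *)
move=> xB; pose cs i : seq int := if i == 0%N then [:: -1; 0; 0; 0; 0; 0; 1; 1; 1]
  else mkseq (fun l => (l.+1 == i)%:Z - (l == i)%:Z) 9.
have csP : all (fun i => all (fun k => 2 * (cycle_root_coords i)`_k ==
    foldr (fun l y => (cs i)`_l * (nth [::] base_cluster l)`_k + y) 0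
      (index_iota 0 9)) (iota 0 10)) (iota 0 9) by vm_compute.
have xroot i : lform G x (cycle_root i) = 0.
  have iE : 2 *: cycle_root i =
      \sum_(l < 9) ((cs i)`_l)%:~R *: vec (nth [::] base_cluster l).
    apply/rowP => k; rewrite summxE !mxE.
    move: csP => /allP/(_ i)/[!mem_iota]/(_ (ltn_ord i)).
    move=> /allP/(_ k)/[!mem_iota]/(_ (ltn_ord k))/eqP/(congr1 (intr : int -> R)).
    rewrite rmorphM foldr_add_sum big_mkord rmorph_sum => -> /=.
    by apply: eq_bigr => l _; rewrite !mxE rmorphM.
  apply: (@mulfI _ (2 : R)); first by rewrite pnatr_eq0.
  rewrite mulr0 -lformZr iE lform_sumr big1 // => l _.
  by rewrite lformZr xB ?mulr0 // mem_nth.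
have [z xz] := projection_embedding x.
have z0 : z = 0.
  apply: (lform_nondegenerate cycle_tail_unit) => i.
  by rewrite (lform_embedded_root i xz) xroot lform0l.
exists (lform G x h / lform G h h).
by apply/eqP; rewrite -subr_eq0; apply/eqP; rewrite -/(pr x) xz z0 mul0mx.
Qed.

End BaseCrossSection.

(** The word of the normal form takes [h] to a nonzero multiple of [base_h]. The base isometry is
    then followed by the inverse word. *)
Lemma cross_section_cluster (R : realType) (c : 'I_10 -> 'rV[R]_10) k h :
  (forall i, P_beta R (c i)) -> pairwise_tangent (beta_gram R) c -> h != 0 ->
  (forall i, i != k -> lform (beta_gram R) h (c i) = 0) ->
  exists phi : {linear 'rV[R]_9 -> 'rV[R]_10},
    isometry_onto (cycle_tail_gram R) (beta_gram R) phi
      (hyperplane (beta_gram R) h) /\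
    cross_section (beta_gram R) (P_beta R) h = phi @` cycle_tail_packing R.
Proof.
move=> cP cT h0 hc; set G := beta_gram R; set A := embedding_mx R.
have Gs : G^T = G := beta_gram_sym R; have rG := @root_beta R.
have [s sB] := cluster_normal_form k cP cT.
have [|t ht] := @orthogonal_base_cluster R (word G (@basis_vec R 10) s h).
  by move=> l /sB[i ik <-]; rewrite lform_word // hc.
have t0 : t != 0.
  apply: contraNneq h0 => t0.
  by apply/eqP; rewrite -[LHS](wordK Gs rG s) ht t0 (wordZ Gs) scale0r.
have [T sT] := word_mulmx Gs (@basis_vec R 10) (rev s).
exists (mulmxr (A *m T)); split.
  apply: isometry_onto_hyperplane => //.
  - exact: (beta_gram_inv R).1.
  - exact: cycle_tail_unit.
  - apply/matrixP => i j; rewrite -!lform_basis_vec.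
    rewrite -(lform_mulmx (embedding_mxP R)) -/G -[RHS](lform_word Gs rG (rev s)).
    by rewrite !sT /lform !trmx_mul !mulmxA.
  - move=> i; rewrite row_mul -sT -(lform_word Gs rG s) (wordVK Gs rG) ht lformZl.
    by rewrite rowK base_h_cycle_root mulr0.
rewrite (cross_section_word Gs rG s); last by move=> *; exact: P_beta_word.
rewrite ht cross_sectionZ // cross_section_base image_comp.
by congr (_ @` _); apply/funext => x /=; rewrite sT mulmxA.
Qed.

(** * Spanning and the lattice of the packing *)

Section Span.
Variables (R : realType) (n : nat) (P : set 'rV[R]_n).
Implicit Types x y : 'rV[R]_n.

Definition in_span x := exists m (c : 'I_m -> R) (v : 'I_m -> 'rV[R]_n),
  (forall i, P (v i)) /\ x = \sum_(i < m) c i *: v i.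

Lemma in_span_mem x : P x -> in_span x.
Proof.
move=> Px; exists 1, (fun=> 1), (fun=> x); split=> //.
by rewrite big_ord1 scale1r.
Qed.

Lemma in_span0 : in_span 0.
Proof.
by exists 0, (fun=> 0), (fun=> 0); split; [case|rewrite big_ord0].
Qed.

Lemma in_spanZ a x : in_span x -> in_span (a *: x).
Proof.
move=> [m [c [v [vP ->]]]]; exists m, (fun i => a * c i), v; split=> //.
by rewrite scaler_sumr; apply: eq_bigr => i _; rewrite scalerA.
Qed.

Lemma in_spanD x y : in_span x -> in_span y -> in_span (x + y).
Proof.
move=> [m [c [v [vP ->]]]] [p [d [w [wP ->]]]].
exists (m + p)%N, (fun i => match split i with inl j => c j | inr j => d j end).
exists (fun i => match split i with inl j => v j | inr j => w j end).
split=> [i|]; first by case: split.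
rewrite big_split_ord; congr (_ + _); apply: eq_bigr => i _.
  by rewrite (unsplitK (inl i)).
by rewrite (unsplitK (inr i)).
Qed.

Lemma in_span_mulmx T x : (forall v, P v -> P (v *m T)) ->
  in_span x -> in_span (x *m T).
Proof.
move=> PT [m [c [v [vP ->]]]]; exists m, c, (fun i => v i *m T).
split=> [i|]; first exact: PT.
by rewrite mulmx_suml; apply: eq_bigr => i _; rewrite scalemxAl.
Qed.

End Span.

Section CycleTailLattice.
Variable R : realType.
Local Notation K := (cycle_tail_gram R).
Local Notation b := (@basis_vec R 9).
Local Notation P := (cycle_tail_packing R).

Lemma cycle_tail_packing_weight (i : 'I_9) : i.+1 \in [:: 3; 4; 9]%N -> P (weight K i).
Proof.
move=> i349; exists 1, (weight K i); split=> //; last by rewrite scale1r.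
apply/orbit_of_word; first exact: cycle_tail_adjC.
by exists [::], (weight K i); split=> //; exists i.
Qed.

Lemma cycle_tail_packing_reflection i x : P x -> P (reflection K (b i) x).
Proof.
move=> [c [y [c0 yO ->]]]; exists c, (reflection K (b i) y); split=> //.
  case/orbit_of_word: yO => [|s [v [vP ->]]]; first exact: cycle_tail_adjC.
  by apply/orbit_of_word; [exact: cycle_tail_adjC | exists (i :: s), v].
exact: (wordZ (cycle_tail_gram_sym R) b [:: i]).
Qed.

Lemma in_span_cycle_tail_reflection i x :
  in_span P x -> in_span P (reflection K (b i) x).
Proof.
have [T rT] := reflection_mulmx (cycle_tail_gram_sym R) (b i).
rewrite rT; apply: in_span_mulmx => v Pv; rewrite -rT.
exact: cycle_tail_packing_reflection.
Qed.

(** The root is the difference between the reflected vector and [x]. *)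
Lemma in_span_cycle_tail_basis i x : lform K x (b i) = 1 ->
  in_span P x -> in_span P (b i).
Proof.
move=> xi Sx; have := in_span_cycle_tail_reflection i Sx.
rewrite (simple_reflectionE cycle_tail_adjC) xi scale1r => Sxb.
have -> : b i = (x + b i) + (-1) *: x by rewrite scaleN1r addrC addrA addNr add0r.
exact/in_spanD/in_spanZ.
Qed.

Lemma in_span_cycle_tail_adjacent (i j : 'I_9) :
  edge_rel cycle_tail_edges i.+1 j.+1 -> in_span P (b i) -> in_span P (b j).
Proof.
move=> ij; apply: in_span_cycle_tail_basis.
rewrite lform_basis_vec mxE /= ij; case: eqP => // ijE; move: ij; rewrite ijE.
by case: j {ijE} => -[|[|[|[|[|[|[|[|[|j]]]]]]]]].
Qed.

Lemma spans_cycle_tail_packing : spans P.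
Proof.
have Sb i : in_span P (b i).
  have Sb8 : in_span P (b ord_max).
    apply: (@in_span_cycle_tail_basis _ (weight K ord_max)).
      by rewrite form_weight ?cycle_tail_unit // eqxx.
    exact/in_span_mem/cycle_tail_packing_weight.
  (* Reversal makes the induction run from a_9 down to a_1, whose consecutive nodes are adjacent. *)
  have -> : i = rev_ord (rev_ord i) by rewrite rev_ordK.
  case: (rev_ord i) => k; elim: k => [|k IH] k9.
    by congr (in_span P (b _)): Sb8; apply: val_inj.
  have k9' : (k < 9)%N := ltnW k9.
  apply: in_span_cycle_tail_adjacent (IH k9') => /=.
  by move: k k9 {IH k9'} => [|[|[|[|[|[|[|[|k]]]]]]]].
move=> x; rewrite [x]row_sum_basis_vec; apply: (big_ind (in_span P)).
- exact: in_span0.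
- by move=> ? ?; exact: in_spanD.
- by move=> i _; exact: in_spanZ.
Qed.

(** Integrality passes along reflections because the Gram matrix is integral. *)
Lemma cycle_tail_orbit_int s i j :
  lform K (word K b s (weight K i)) (b j) \is a Num.int.
Proof.
elim: s j => [|k s IH] j /=.
  by rewrite form_weight ?cycle_tail_unit //; exact: natr_int.
rewrite (lform_simple_reflection cycle_tail_adjC) rpredD // rpredM //.
by rewrite mxE; case: ifP => _; rewrite ?rpredN natr_int.
Qed.

(** The weight lattice serves, the rows of K^-1 being the weights; dividing by the ray factor
    returns to the orbit of the weights. *)
Lemma general_lattice_type_cycle_tail : general_lattice_type P.
Proof.
split; first exact: spans_cycle_tail_packing.
exists [set map_mx intr z *m invmx K | z in [set: 'rV[int]_9]].
  by exists (invmx K) => //; rewrite unitmx_inv cycle_tail_unit.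
move=> _ [c [y [c0 yO ->]]]; exists c^-1; first by rewrite invr_eq0 gt_eqF.
rewrite scalerA mulVf ?gt_eqF // scale1r.
case/orbit_of_word: yO => [|s [_ [[i _ <-] ->]]]; first exact: cycle_tail_adjC.
set x := word _ _ _ _; exists (\row_j Num.floor (lform K x (b j))) => //.
rewrite -[RHS](mulmxK (cycle_tail_unit R)); congr (_ *m _); apply/rowP => j.
by rewrite [LHS]mxE [in LHS]mxE floorK ?cycle_tail_orbit_int // lform_basis_vecr.
Qed.

End CycleTailLattice.

Theorem theorem4p1 (R : realType) :
  (forall (c : 'I_10 -> 'rV[R]_10) (k : 'I_10) (h : 'rV[R]_10),
     (forall i, P_beta R (c i)) ->
     pairwise_tangent (beta_gram R) c ->
     h != 0 ->
     (forall i, i != k -> lform (beta_gram R) h (c i) = 0) ->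
     exists phi : {linear 'rV[R]_9 -> 'rV[R]_10},
       isometry_onto (cycle_tail_gram R) (beta_gram R) phi
         (hyperplane (beta_gram R) h) /\
       cross_section (beta_gram R) (P_beta R) h =
         phi @` cycle_tail_packing R) /\
  general_lattice_type (cycle_tail_packing R).
Proof.
split; last exact: general_lattice_type_cycle_tail.
by move=> c k h cP cT h0 hc; exact: (cross_section_cluster cP cT h0 hc).
Qed.
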